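(* Let $N,\ell$ be positive integers and let $\mathcal F\subseteq\{-1,+1\}^N$ be a family of binary sequences. Let $F_N=\{f_1,\dots,f_N\}$, $G_N=\{g_1,\dots,g_N\}$, $H_N=\{h_1,\dots,h_N\}$ be three distinct sequences in $\mathcal F$, and define $E_N=\{e_1,\dots,e_N\}\in\{-1,+1\}^N$ by $e_n=f_n$ if $h_n=1$ and $e_n=g_n$ if $h_n=-1$. Then \[ C_{\ell}(E_N)\le 2^{\ell}\max_{\ell\le m\le 2\ell}\Phi_m(\mathcal F). \]
   Context: For $E_N=\{e_1,\dots,e_N\}\in\{-1,+1\}^N$, the correlation measure of order $\ell$ is $C_{\ell}(E_N)=\max_{M,D}\left|\sum_{n=1}^{M}e_{n+d_1}\cdots e_{n+d_\ell}\right|$, the maximum over all $M\in\mathbb N$ and $D=(d_1,\dots,d_\ell)$ of integers with $0\le d_1<\dots<d_\ell<M+d_\ell\le N$. Cross-correlation measure: for binary sequences $E^{(1)},\dots,E^{(m)}\in\{-1,+1\}^N$, $E^{(i)}=(e^{(i)}_1,\dots,e^{(i)}_N)$, $M\in\mathbb N$ and $D=(d_1,\dots,d_m)$ non-negative integers with $0\le d_1\le\dots\le d_m<M+d_m\le N$, put $V_m(E^{(1)},\dots,E^{(m)},M,D)=\sum_{n=1}^{M}e^{(1)}_{n+d_1}\cdots e^{(m)}_{n+d_m}$, and let $\tilde C_m(E^{(1)},\dots,E^{(m)})=\max_{M,D}|V_m(E^{(1)},\dots,E^{(m)},M,D)|$, the maximum over such $M,D$ with the extra restriction that if $E^{(i)}=E^{(j)}$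 for some $i\ne j$ then $d_i\ne d_j$. The cross-correlation measure of order $m$ of $\mathcal F$ is $\Phi_m(\mathcal F)=\max\tilde C_m(E^{(1)},\dots,E^{(m)})$ over all $m$-tuples with $E^{(i)}\in\mathcal F$ for all $i$. *)

(* Defs.v *)
From mathcomp Require Import all_boot all_order all_algebra.

Set Implicit Arguments.
Unset Strict Implicit.
Unset Printing Implicit Defensive.

Import GRing.Theory Num.Theory.
Local Open Scope ring_scope.

(* The set {-1, +1} of integers, as a finite type; [ssval : sign -> int] is the
   inclusion. *)
Definition sign := seq_sub [:: -1; 1 : int].

Definition binseq (N : nat) := {ffun 'I_N -> sign}.

(* [entry E k] is e_k with the indices starting at 1, i.e. E = (e_1, ..., e_N);
   the value 0 for k outside 1..N never occurs in the sums below, whose index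
   ranges are restricted by the admissibility conditions. *)
Definition entry (N : nat) (E : binseq N) (k : nat) : int :=
  if k is k'.+1 then if insub k' is Some i then ssval (E i) else 0 else 0.

(* In both measures admissibility forces M <= N and d_i <= N, so M and the d_i
   range over 'I_N.+1 without loss.  Absolute values are taken in nat, and the
   maximum of an empty set of values (e.g. if l > N) is 0. *)

(* 0 <= d_1 < ... < d_l < M + d_l <= N *)
Definition adm_lt (N l : nat) (M : nat) (D : l.-tuple 'I_N.+1) : bool :=
  let d := map val D in
  sorted ltn d && (last 0%N d < M + last 0%N d <= N)%N.

Definition auto_sum (N l : nat) (E : binseq N) (M : nat)
    (D : l.-tuple 'I_N.+1) : int :=
  \sum_(1 <= n < M.+1) \prod_(i < l) entry E (n + tnth D i)%N.

Definition correlation (N l : nat) (E : binseq N) : nat :=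
  \max_(M < N.+1) \max_(D : l.-tuple 'I_N.+1 | adm_lt M D)
    `| auto_sum E M D |%N.

(* 0 <= d_1 <= ... <= d_m < M + d_m <= N *)
Definition adm_le (N m : nat) (M : nat) (D : m.-tuple 'I_N.+1) : bool :=
  let d := map val D in
  sorted leq d && (last 0%N d < M + last 0%N d <= N)%N.

Definition distinct_shifts (N m : nat) (Es : m.-tuple (binseq N))
    (D : m.-tuple 'I_N.+1) : bool :=
  [forall i : 'I_m, forall j : 'I_m,
    (i != j) && (tnth Es i == tnth Es j) ==> (tnth D i != tnth D j)].

Definition cross_sum (N m : nat) (Es : m.-tuple (binseq N)) (M : nat)
    (D : m.-tuple 'I_N.+1) : int :=
  \sum_(1 <= n < M.+1) \prod_(i < m) entry (tnth Es i) (n + tnth D i)%N.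

Definition cross_correlation (N m : nat) (Es : m.-tuple (binseq N)) : nat :=
  \max_(M < N.+1)
    \max_(D : m.-tuple 'I_N.+1 | adm_le M D && distinct_shifts Es D)
      `| cross_sum Es M D |%N.

Definition family_cross_correlation (N m : nat) (F : {set binseq N}) : nat :=
  \max_(Es : m.-tuple (binseq N) | [forall i, tnth Es i \in F])
    cross_correlation Es.

(* Main.v *)
(** Since [h_n = 1] or [-1], one has
    [2 e_n = f_n + g_n + h_n f_n - h_n g_n].  Multiplying these identities over
    the [l] shifts and expanding gives [4 ^ l] signed products of between [l]
    and [2 l] entries of [f], [g], [h].  Factors with equal shifts come from the
    same [e_(n + d_i)], hence from distinct sequences, so every such product is
    admissible for [Phi_m].  Thus [2 ^ l C_l <= 4 ^ l max_m Phi_m]. *)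
Require Import Defs.
From mathcomp Require Import all_boot all_order all_algebra.
From mathcomp Require Import ring.

Import Order.TTheory GRing.Theory Num.Theory.

Local Open Scope ring_scope.

(** Repeating each shift in place creates only equal neighbours, which the weak order of [adm_le]
    allows. *)
Lemma sorted_leq_flatten_nseq (I : Type) (w d : I -> nat) (r : seq I) :
  sorted leq (map d r) -> sorted leq (flatten [seq nseq (w i) (d i) | i <- r]).
Proof.
rewrite !(sorted_pairwise leq_trans).
elim: r => //= i r IHr /andP[le_ir /IHr {}IHr].
rewrite pairwise_cat IHr andbT; apply/andP; split; last first.
  by elim: (w i) => //= k ->; rewrite all_nseq leqnn orbT.
rewrite /allrel all_nseq; apply/orP; right.
elim: r le_ir {IHr} => //= j r IHr /andP[le_ij /IHr {}IHr].
by rewrite all_cat IHr andbT all_nseq le_ij orbT.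
Qed.

(** No block is empty, so the largest shift survives, and with it the condition on [M]. *)
Lemma last_flatten_nseq (I : Type) (w d : I -> nat) (r : seq I) (x : nat) :
  (forall i, 0 < w i)%N ->
  last x (flatten [seq nseq (w i) (d i) | i <- r]) = last x (map d r).
Proof.
move=> w_gt0; elim: r x => //= i r IHr x.
rewrite last_cat IHr; congr (last _ _).
by case: (w i) (w_gt0 i) => // k _; elim: k.
Qed.

(** Listing sequences together with their shifts turns [distinct_shifts] into [uniq s]: equal
    sequences with equal shifts would be a repeated pair. *)
Lemma leq_abs_sum_family_cross_correlation (N M : nat) (F : {set binseq N})
    (s : seq (binseq N * 'I_N.+1)) (d := [seq val p.2 | p <- s]) :
  all (fun p => p.1 \in F) s -> uniq s -> sorted leq d ->
  (last 0%N d < M + last 0%N d <= N)%N ->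
  (`|(\sum_(1 <= n < M.+1) \prod_(p <- s) entry p.1 (n + p.2)%N)%R|%N
     <= family_cross_correlation (size s) F)%N.
Proof.
move=> sF s_uniq d_sorted bounds.
pose Es := map_tuple fst (in_tuple s); pose D := map_tuple snd (in_tuple s).
have -> : \sum_(1 <= n < M.+1) \prod_(p <- s) entry p.1 (n + p.2)%N
          = cross_sum Es M D.
  apply: eq_bigr => n _; rewrite big_tnth; apply: eq_bigr => i _.
  by rewrite !tnth_map.
have ltMN : (M < N.+1)%N.
  by case/andP: bounds => _; apply: leq_trans; apply: leq_addr.
have Dd : map val D = d by rewrite /= -map_comp.
apply: leq_trans (leq_bigmax_cond Es _); last first.
  apply/forallP => i; rewrite tnth_map.
  by move/allP: sF; apply; apply: mem_tnth.
apply: leq_trans (leq_bigmax (Ordinal ltMN)).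
apply: (@leq_bigmax_cond _ _ (fun D => `|cross_sum Es M D|%N) D).
rewrite /adm_le Dd d_sorted bounds /=.
apply/forallP => i; apply/forallP => j; apply/implyP => /andP[neq_ij].
rewrite !tnth_map => /eqP eqE; apply: contra neq_ij => /eqP eqD.
apply/eqP; apply: (tuple_uniqP (in_tuple s) s_uniq).
by rewrite [LHS]surjective_pairing eqE eqD -surjective_pairing.
Qed.

Section Expansion.

Variables (N : nat) (f g h : binseq N).

(* The indices of the four terms [f_n], [g_n], [h_n f_n], [- h_n g_n]: the first
   bit selects the factor [h_n], the second one [g] instead of [f]. *)
Definition factors (c : bool * bool) : seq (binseq N) :=
  let x := if c.2 then g else f in if c.1 then [:: h; x] else [:: x].

Lemma entry_expansion (E : binseq N) (k : nat) :
  (forall n : 'I_N, ssval (h n) = 1 -> E n = f n) ->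
  (forall n : 'I_N, ssval (h n) = -1 -> E n = g n) ->
  2 * entry E k =
    \sum_(c : bool * bool)
      (-1) ^+ (c.1 && c.2) * \prod_(x <- factors c) entry x k.
Proof.
move=> Ef Eg.
rewrite -(pair_bigA _ (fun a b =>
  (-1) ^+ (a && b) * \prod_(x <- factors (a, b)) entry x k)) /=.
rewrite !big_bool /factors /= !big_cons !big_nil !expr0 expr1.
(* At index 0 or beyond [N] every entry takes the default value 0, so both sides vanish. *)
case: k => [|k] /=; first by rewrite !mulr0.
case: insubP => [i _ _|_]; last by rewrite !mulr0.
have := ssvalP (h i); rewrite !inE => /orP[] /eqP hi.
  by rewrite (Eg _ hi) hi; ring.
by rewrite (Ef _ hi) hi; ring.
Qed.

Variables (l : nat) (D : l.-tuple 'I_N.+1).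

(** The function [c] picks one of the four terms at each shift. Running through the indices in order
    keeps the shifts sorted. *)
Definition choice_factors (c : {ffun 'I_l -> bool * bool}) :
    seq (binseq N * 'I_N.+1) :=
  [seq (x, tnth D i) | i <- enum 'I_l, x <- factors (c i)].

(** The product over [i] of four-term sums is distributed over all choices [c]; the sign of a choice
    does not depend on [n] and leaves the inner sum. *)
Lemma auto_sum_expansion (E : binseq N) (M : nat) :
  (forall n : 'I_N, ssval (h n) = 1 -> E n = f n) ->
  (forall n : 'I_N, ssval (h n) = -1 -> E n = g n) ->
  2 ^+ l * auto_sum E M D =
    \sum_(c : {ffun 'I_l -> bool * bool})
      (\prod_(i < l) (-1) ^+ ((c i).1 && (c i).2)) *
      \sum_(1 <= n < M.+1)
        \prod_(p <- choice_factors c) entry p.1 (n + p.2)%N.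
Proof.
move=> Ef Eg.
rewrite (eq_bigr _ (fun c _ => big_distrr _ _ _)) exchange_big big_distrr /=.
apply: eq_bigr => n _.
have -> : 2 ^+ l = \prod_(i < l) 2 :> int by rewrite prodr_const card_ord.
rewrite -big_split /=.
rewrite (eq_bigr _ (fun i _ => entry_expansion _ (n + tnth D i)%N Ef Eg)).
rewrite bigA_distr_bigA; apply: eq_bigr => c _.
by rewrite big_split big_allpairs_dep big_enum.
Qed.

Lemma map_snd_choice_factors (c : {ffun 'I_l -> bool * bool}) :
  [seq val p.2 | p <- choice_factors c] =
  flatten [seq nseq (size (factors (c i))) (val (tnth D i)) | i <- enum 'I_l].
Proof.
rewrite /choice_factors map_flatten -map_comp; congr flatten.
by apply: eq_map => i /=; elim: (factors _) => //= x r ->.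
Qed.

Lemma size_factors (c : bool * bool) : (0 < size (factors c) <= 2)%N.
Proof. by case: c => [[] []]. Qed.

Lemma size_choice_factors (c : {ffun 'I_l -> bool * bool}) :
  (l <= size (choice_factors c) <= 2 * l)%N.
Proof.
rewrite size_allpairs_dep sumnE big_map big_enum /=.
apply/andP; split.
  rewrite -[leqLHS]card_ord -sum1_card; apply: leq_sum => i _.
  by case/andP: (size_factors (c i)).
rewrite -[l in leqRHS]card_ord mulnC -sum_nat_const; apply: leq_sum => i _.
by case/andP: (size_factors (c i)).
Qed.

(** Pairs from different indices differ in their shift; two pairs from the same index carry [h] and
    one of [f], [g]. *)
Lemma uniq_choice_factors (c : {ffun 'I_l -> bool * bool}) :
  f <> h -> g <> h -> uniq D -> uniq (choice_factors c).
Proof.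
move=> fh gh /tuple_uniqP Dinj.
apply: allpairs_uniq_dep; first exact: enum_uniq.
  move=> i _; case: (c i) => [[] []] //=; rewrite inE andbT eq_sym;
  exact/eqP.
by move=> [i x] [j y] _ _ /= [-> /Dinj ->].
Qed.

Lemma choice_factors_sub (F : {set binseq N}) (c : {ffun 'I_l -> bool * bool}) :
  f \in F -> g \in F -> h \in F ->
  all (fun p => p.1 \in F) (choice_factors c).
Proof.
move=> fF gF hF; apply/allP => _ /allpairsPdep[i [x [_ xc ->]]] /=.
by move: xc; case: (c i) => [[] []]; rewrite !inE /=;
   first [case/orP|idtac]; move=> /eqP->.
Qed.

Lemma leq_abs_choice_sum (F : {set binseq N}) (M : nat)
    (c : {ffun 'I_l -> bool * bool}) :
  f \in F -> g \in F -> h \in F -> f <> h -> g <> h -> adm_lt M D ->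
  (`|(\sum_(1 <= n < M.+1)
         \prod_(p <- choice_factors c) entry p.1 (n + p.2)%N)%R|
     <= \max_(l <= m < (2 * l).+1) family_cross_correlation m F)%N.
Proof.
move=> fF gF hF fh gh /andP[D_sorted bounds].
have mapD : [seq val (tnth D i) | i <- enum 'I_l] = map val D.
  by rewrite map_comp map_tnth_enum.
have D_uniq : uniq D.
  by rewrite -(map_inj_uniq val_inj); exact: (sorted_uniq ltn_trans ltnn D_sorted).
have lastE : last 0%N [seq val p.2 | p <- choice_factors c]
             = last 0%N (map val D).
  rewrite map_snd_choice_factors last_flatten_nseq ?mapD // => i.
  by case/andP: (size_factors (c i)).
apply: leq_trans (leq_abs_sum_family_cross_correlation _ _ F _ _ _ _ _) _.
- exact: choice_factors_sub.
- exact: uniq_choice_factors.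
(* A shift occurs twice where [h] is chosen, so strict order weakens to [leq]. *)
- rewrite map_snd_choice_factors; apply: sorted_leq_flatten_nseq.
  by rewrite mapD; apply: sub_sorted D_sorted => a b; apply: ltnW.
- by rewrite lastE.
- apply: leq_bigmax_seq => //.
  by rewrite mem_index_iota ltnS size_choice_factors.
Qed.

End Expansion.

Theorem theorem3 (N l : nat) (hN : (0 < N)%N) (hl : (0 < l)%N)
  (F : {set binseq N}) (f g h : binseq N)
  (fF : f \in F) (gF : g \in F) (hF : h \in F)
  (fg : f <> g) (fh : f <> h) (gh : g <> h)
  (E : binseq N)
  (Ef : forall n : 'I_N, ssval (h n) = 1 -> E n = f n)
  (Eg : forall n : 'I_N, ssval (h n) = -1 -> E n = g n) :
  (correlation l E <=
     2 ^ l * \max_(l <= m < (2 * l).+1) family_cross_correlation m F)%N.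
Proof.
apply/bigmax_leqP => M _; apply/bigmax_leqP => D admD.
(* Multiplying by [2 ^ l] clears the denominators of the expansion and leaves [(2 * 2) ^ l] on the
   right. *)
rewrite -(leq_pmul2l (expn_gt0 2 l)) mulnA -expnMn.
have PoszX k : (k ^ l)%N = k%:Z ^+ l :> int by rewrite -natz natrX natz.
rewrite -lez_nat !PoszM !PoszX abszE.
rewrite -[X in X * _ <= _](ger0_norm (exprn_ge0 l (ler0n _ 2))) -normrM.
rewrite (auto_sum_expansion _ f g h _ D E M Ef Eg).
apply: le_trans (ler_norm_sum _ _ _) _.
(* This constant counts the choices [c], so it suffices to bound each term by the maximum. *)
have -> : (2 * 2)%N%:Z ^+ l = #|{ffun 'I_l -> bool * bool}|%:Z.
  by rewrite card_ffun card_prod card_bool card_ord PoszX.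
rewrite -PoszM -sum_nat_const -natz natr_sum.
apply: ler_sum => c _.
rewrite normrM normr_prod big1 => [|i _]; last by rewrite normr_sign.
by rewrite mul1r natz -abszE lez_nat leq_abs_choice_sum.
Qed.
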